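(* Suppose that Assumption B (stated in the context) holds for the QCQP $(\mathcal{P})$ and that its aggregated sparsity pattern graph $G(\mathcal{V},\mathcal{E})$ is bipartite. Then the SDP relaxation $(\mathcal{P}_R)$ is exact if, for every $(k,\ell)\in\mathcal{E}$, there is no $y\in\mathbb{R}^m$ satisfying $$y\ge 0,\qquad S(y)\succeq O,\qquad S(y)_{k\ell}\le 0 .$$
   Context: Let $\mathbb{S}^n$ be the space of real symmetric $n\times n$ matrices, $[m]=\{1,\dots,m\}$, $[0,m]=\{0,1,\dots,m\}$, and $A\bullet B=\sum_{i,j}A_{ij}B_{ij}$. Let $Q^0,\dots,Q^m\in\mathbb{S}^n$ and $b\in\mathbb{R}^m$. Consider the QCQP $(\mathcal{P})$: minimize $x^TQ^0x$ over $x\in\mathbb{R}^n$ subject to $x^TQ^px\le b_p$ for $p\in[m]$. Throughout, $(\mathcal{P})$ is assumed to be feasible. Its SDP relaxation $(\mathcal{P}_R)$ is: minimize $Q^0\bullet X$ over $X\in\mathbb{S}^n$ subject to $Q^p\bullet X\le b_p$ for $p\in[m]$, $X\succeq O$ (positive semidefinite). The dual $(\mathcal{D}_R)$ is: maximize $-b^Ty$ over $y\in\mathbb{R}^m$ subject to $y\ge 0$ and $S(y):=Q^0+\sum_{p=1}^m y_pQ^p\succeq O$. The SDP relaxation is called exact if $(\mathcal{P}_R)$ has an optimal solution of rank at most $1$. The aggregated sparsity pattern graph of $(\mathcal{P})$ is the undirected graph $G(\mathcal{V},\mathcal{E})$ with $\mathcal{V}=[n]$ and $\mathcal{E}=\{(i,j):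 i\ne j,\ Q^p_{ij}\neq 0\text{ for some }p\in[0,m]\}$. The graph need not be connected. Assumption B: (i) the sets of optimal solutions of $(\mathcal{P}_R)$ and of $(\mathcal{D}_R)$ are both nonempty; and (ii) at least one of the following holds: (a) the feasible set of $(\mathcal{P}_R)$ is bounded; or (b) for $(\mathcal{D}_R)$, the set of optimal solutions is bounded and the interior of the feasible set is nonempty, in the sense that there is a feasible $\bar y$ with $S(\bar y)\succ O$ (positive definite). *)

(* Defs.v *)
From mathcomp Require Import all_boot all_order all_algebra.
From mathcomp Require Import all_classical all_reals all_analysis.

Set Implicit Arguments.
Unset Strict Implicit.
Unset Printing Implicit Defensive.

Import Order.TTheory GRing.Theory Num.Theory.
Import numFieldNormedType.Exports.

Local Open Scope classical_set_scope.
Local Open Scope ring_scope.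

Section Matrices.
Variables (R : realType) (n : nat).
Implicit Types (A B : 'M[R]_n) (x : 'cV[R]_n).

Definition frobenius A B : R := \sum_i \sum_j A i j * B i j.

Definition quad_form A x : R := (x^T *m A *m x) 0 0.

Definition psd A : Prop :=
  A \is symmetricmx /\ forall x, 0 <= quad_form A x.

Definition pd A : Prop :=
  A \is symmetricmx /\ forall x, x != 0 -> 0 < quad_form A x.

End Matrices.

Definition bipartite (T : finType) (e : rel T) : Prop :=
  exists L : {set T}, forall i j, e i j -> (i \in L) != (j \in L).

(* The data (Q, b) encode the QCQP with objective matrix Q^0 = Q ord0 and, for
   p : 'I_m, constraint matrix Q (lift ord0 p) and right-hand side b p 0. *)
Section QCQP.
Variables (R : realType) (n m : nat).
Variables (Q : 'I_m.+1 -> 'M[R]_n) (b : 'cV[R]_m).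

Definition qcqp_feasible : set 'cV[R]_n :=
  [set x : 'cV[R]_n | forall p : 'I_m, quad_form (Q (lift ord0 p)) x <= b p 0].

Definition sdp_feasible : set 'M[R]_n :=
  [set X : 'M[R]_n | psd X /\
           forall p : 'I_m, frobenius (Q (lift ord0 p)) X <= b p 0].

Definition sdp_optimal : set 'M[R]_n :=
  [set X : 'M[R]_n | sdp_feasible X /\
           forall X', sdp_feasible X' ->
             frobenius (Q ord0) X <= frobenius (Q ord0) X'].

Definition dual_slack (y : 'cV[R]_m) : 'M[R]_n :=
  Q ord0 + \sum_(p < m) y p 0 *: Q (lift ord0 p).

Definition dual_feasible : set 'cV[R]_m :=
  [set y : 'cV[R]_m | (forall p : 'I_m, 0 <= y p 0) /\ psd (dual_slack y)].

Definition dual_objective (y : 'cV[R]_m) : R := - (b^T *m y) 0 0.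

Definition dual_optimal : set 'cV[R]_m :=
  [set y : 'cV[R]_m | dual_feasible y /\
           forall y', dual_feasible y' ->
             dual_objective y' <= dual_objective y].

Definition sdp_exact : Prop :=
  exists2 X, sdp_optimal X & (\rank X <= 1)%N.

Definition sparsity_edge : rel 'I_n :=
  fun i j => (i != j) && [exists p, Q p i j != 0].

Definition assumptionB : Prop :=
  [/\ sdp_optimal !=set0,
      dual_optimal !=set0
    & bounded_set sdp_feasible \/
      (bounded_set dual_optimal /\
       exists2 y, dual_feasible y & pd (dual_slack y))].

End QCQP.

(* Main.v *)
Require Import Defs.
From mathcomp Require Import all_boot all_order all_algebra.
From mathcomp Require Import all_classical all_reals all_analysis.
From mathcomp Require Import ring lra.

Import Order.TTheory GRing.Theory Num.Theory.
Import numFieldNormedType.Exports.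

Local Open Scope classical_set_scope.
Local Open Scope ring_scope.

(* Let L be one side of the bipartition. The hypothesis on the edges says that
   every feasible dual slack S has S_kl > 0 on each edge, so that flipping the
   signs of the coordinates in L makes its off-diagonal entries nonpositive. For
   psd X let z_i = (-1)^[i in L] sqrt(X_ii). Since |X_kl| <= sqrt(X_kk X_ll), we
   get z^T S z <= S . X entry by entry; if S . X <= 0 then, S being psd, both
   sides vanish and z_k z_l = X_kl on every edge. The data matrices only see the
   diagonal and the edges, so z z^T has the same objective and constraint values
   as X.

   A primal optimal X and a dual optimal y with S(y) . X <= 0 come from a Farkas
   alternative for the psd cone, proved by minimising the squared positive parts
   of the residuals; the minimum is attained because Assumption B excludes
   nonzero psd Z with Q^p . Z <= 0 for all p in [0,m]. *)

(** * Linearity of the Frobenius product *)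

Section Frobenius.
Context {R : realType} {n : nat}.
Implicit Types (A B X : 'M[R]_n) (x : 'cV[R]_n).

Lemma quad_form_frobenius A x : quad_form A x = frobenius A (x *m x^T).
Proof.
rewrite /quad_form /frobenius mxE exchange_big /=; apply: eq_bigr => j _.
rewrite !mxE mulr_suml; apply: eq_bigr => i _.
by rewrite !mxE big_ord1 !mxE; ring.
Qed.

Lemma frobeniusC A B : frobenius A B = frobenius B A.
Proof. by do 2![apply: eq_bigr => ? _]; rewrite mulrC. Qed.

Lemma frobeniusDr A X Y : frobenius A (X + Y) = frobenius A X + frobenius A Y.
Proof.
rewrite /frobenius -big_split; apply: eq_bigr => i _ /=.
by rewrite -big_split; apply: eq_bigr => j _; rewrite mxE mulrDr.
Qed.

Lemma frobeniusZr A a X : frobenius A (a *: X) = a * frobenius A X.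
Proof.
rewrite /frobenius mulr_sumr; apply: eq_bigr => i _.
by rewrite mulr_sumr; apply: eq_bigr => j _; rewrite mxE mulrCA.
Qed.

Lemma frobenius0r A : frobenius A 0 = 0.
Proof. by rewrite -(scale0r 0) frobeniusZr mul0r. Qed.

Lemma frobenius_suml (I : finType) (a : I -> R) (A : I -> 'M[R]_n) X :
  frobenius (\sum_i a i *: A i) X = \sum_i a i * frobenius (A i) X.
Proof.
rewrite frobeniusC; transitivity (\sum_i frobenius X (a i *: A i)).
  by apply: (big_morph _ (frobeniusDr X)); rewrite frobenius0r.
by apply: eq_bigr => i _; rewrite frobeniusZr frobeniusC.
Qed.

End Frobenius.

(** * The psd cone and its two-by-two minors *)

Section PositiveSemidefinite.
Context {R : realType} {n : nat}.
Implicit Types (A B X Y : 'M[R]_n) (x : 'cV[R]_n).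

Lemma symmetricmxP A : A \is symmetricmx <-> forall i j, A i j = A j i.
Proof.
split=> [/is_hermitianmxP sA i j|sA].
  by rewrite {1}sA expr0 scale1r !mxE.
by apply/is_hermitianmxP/matrixP => i j; rewrite expr0 scale1r !mxE.
Qed.

Lemma psd_sym X i j : psd X -> X i j = X j i.
Proof. by case=> /symmetricmxP. Qed.

Lemma psd_outer x : psd (x *m x^T).
Proof.
split=> [|z].
  by apply/symmetricmxP => i j; rewrite !mxE !big_ord1 !mxE mulrC.
rewrite /quad_form mulmxA -mulmxA mxE big_ord1.
have -> : (x^T *m z) 0 0 = (z^T *m x) 0 0.
  by rewrite -[x in RHS]trmxK -trmx_mul [RHS]mxE.
by rewrite -expr2 sqr_ge0.
Qed.

Lemma psd0 : psd (0 : 'M[R]_n).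
Proof. by have := psd_outer 0; rewrite mul0mx. Qed.

Lemma psdD X Y : psd X -> psd Y -> psd (X + Y).
Proof.
move=> [/symmetricmxP sX pX] [/symmetricmxP sY pY]; split=> [|z].
  by apply/symmetricmxP => i j; rewrite !mxE sX sY.
by rewrite quad_form_frobenius frobeniusC frobeniusDr addr_ge0 // frobeniusC
   -quad_form_frobenius.
Qed.

Lemma psdZ a X : 0 <= a -> psd X -> psd (a *: X).
Proof.
move=> a0 [/symmetricmxP sX pX]; split=> [|z].
  by apply/symmetricmxP => i j; rewrite !mxE sX.
by rewrite quad_form_frobenius frobeniusC frobeniusZr mulr_ge0 // frobeniusC
   -quad_form_frobenius.
Qed.

Lemma quad_form_delta2 X i j (s t : R) :
  quad_form X (s *: delta_mx i 0 + t *: delta_mx j 0) =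
  s ^+ 2 * X i i + s * t * (X i j + X j i) + t ^+ 2 * X j j.
Proof.
have e k l : (delta_mx k (0 : 'I_1))^T *m X *m delta_mx l (0 : 'I_1) = (X k l)%:M.
  by rewrite trmx_delta -rowE -colE; apply/matrixP => a b; rewrite !ord1 !mxE eqxx.
rewrite /quad_form; have -> : (s *: delta_mx i (0 : 'I_1) + t *: delta_mx j 0)^T =
    s *: (delta_mx i (0 : 'I_1))^T + t *: (delta_mx j 0)^T.
  by rewrite linearD !linearZ.
rewrite !mulmxDl !mulmxDr -!scalemxAl -!scalemxAr.
by rewrite !e !mxE /=; ring.
Qed.

Lemma psd_minor X i j : psd X -> X i j ^+ 2 <= X i i * X j j.
Proof.
move=> pX; have sX := psd_sym X i j pX; case: pX => _ pX.
have q s t := pX (s *: delta_mx i 0 + t *: delta_mx j 0).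
(* The last two test vectors give [X j j] and [X i i] times the minor, so a positive diagonal entry
   settles the sign. If both diagonal entries vanish, (1, 1) and (1, -1) force [X i j] = 0. *)
move: (q 1 0) (q 0 1) (q 1 1) (q 1 (-1)) (q (X j j) (- X i j)) (q (- X i j) (X i i)).
rewrite !quad_form_delta2 -sX; clear.
move: (X i i) (X j j) (X i j) => a b c a0 b0 p1 p2 p3 p4.
have {}a0 : 0 <= a by lra.
have {}b0 : 0 <= b by lra.
have {}p3 : 0 <= b * (a * b - c ^+ 2) by nra.
have {}p4 : 0 <= a * (a * b - c ^+ 2) by nra.
rewrite -subr_ge0; case: (ltgtP 0 b) => [b1||b1]; [|lra|].
  by rewrite -(pmulr_rge0 _ b1).
case: (ltgtP 0 a) => [a1||a1]; [|lra|].
  by rewrite -(pmulr_rge0 _ a1).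
by have -> : c = 0 by [lra]; rewrite -a1; nra.
Qed.

Lemma psd_diag_ge0 X i : psd X -> 0 <= X i i.
Proof.
case=> _ /(_ (1 *: delta_mx i 0 + 0 *: delta_mx i 0)).
by rewrite quad_form_delta2; lra.
Qed.

Lemma psd_le_sqrt_diag X i j : psd X ->
  `|X i j| <= Num.sqrt (X i i) * Num.sqrt (X j j).
Proof.
move=> pX; rewrite -sqrtrM ?psd_diag_ge0// -sqrtr_sqr.
by rewrite ler_wsqrtr ?psd_minor.
Qed.

End PositiveSemidefinite.

(** * Compactness and closedness in matrix space *)

Section MatrixTopology.
Context {R : realType}.

Lemma mx_norm_coord (m n : nat) (M : 'M[R]_(m, n)) i j : `|M i j| <= `|M|.
Proof.
rewrite [leRHS]/Num.norm /= mx_normrE.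
by have := le_bigmax 0 (fun ij : 'I_m * 'I_n => `|M ij.1 ij.2|) (i, j).
Qed.

Lemma mx_norm_le (m n : nat) (M : 'M[R]_(m, n)) (c : R) :
  0 <= c -> (forall i j, `|M i j| <= c) -> `|M| <= c.
Proof.
move=> c0 Mc; rewrite [leLHS]/Num.norm /= mx_normrE.
by apply: bigmax_le => // -[i j] _; exact: Mc.
Qed.

Lemma vec_mx_continuous (m n : nat) :
  continuous (vec_mx : 'rV[R]_(m * n) -> 'M[R]_(m, n)).
Proof.
move=> v s /nbhs_ballP[e e0 es]; apply/nbhs_ballP; exists e => // w [_ vw].
by apply: es; split=> // i j; rewrite !mxE; exact: vw.
Qed.

(** Heine-Borel for row vectors, carried over by the continuous bijection [vec_mx], which does not
    change the entries and hence preserves bounds. *)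
Lemma bounded_closed_compact_mx (m n : nat) (A : set 'M[R]_(m, n)) (c : R) :
  (forall M, A M -> `|M| <= c) -> closed A -> compact A.
Proof.
move=> Ac clA.
have -> : A = vec_mx @` (vec_mx @^-1` A).
  apply/seteqP; split=> [M AM|_ [v Av <-]//].
  by exists (mxvec M); rewrite /= mxvecK.
apply: continuous_compact.
  exact/continuous_subspaceT/vec_mx_continuous.
apply: bounded_closed_compact.
  exists `|c|; split; first exact: normr_real.
  move=> d cd v Av; have d0 : 0 <= d by rewrite (le_trans _ (ltW cd)).
  apply: mx_norm_le => // i k; rewrite ord1.
  case/mxvec_indexP: k => k l.
  have -> : v 0 (mxvec_index k l) = vec_mx v k l by rewrite mxE.
  rewrite (le_trans (mx_norm_coord _ _ _ _ _))// (le_trans (Ac (vec_mx v) Av))//.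
  by rewrite (le_trans (ler_norm _))// ltW.
by apply: closed_comp => // v _; exact: vec_mx_continuous.
Qed.

Lemma continuous_sum (T : topologicalType) (I : Type) (r : seq I)
    (f : I -> T -> R) : (forall i, continuous (f i)) ->
  continuous (fun x => \sum_(i <- r) f i x).
Proof.
move=> cf x; apply: cvg_big => [|i _]; first exact: add_continuous.
exact: cf.
Qed.

Lemma frobenius_continuous (n : nat) (A : 'M[R]_n) : continuous (frobenius A).
Proof.
apply: continuous_sum => i; apply: continuous_sum => j X.
apply: (@continuousM _ _ (fun=> A i j) (fun X : 'M[R]_n => X i j)).
  exact: cst_continuous.
exact: coord_continuous.
Qed.

Lemma psd_closed (n : nat) : closed [set X : 'M[R]_n | psd X].
Proof.
have -> : [set X : 'M[R]_n | psd X] =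
    (\bigcap_(ij in [set: 'I_n * 'I_n])
       [set X : 'M[R]_n | X ij.1 ij.2 - X ij.2 ij.1 = 0]) `&`
    (\bigcap_(x in [set: 'cV[R]_n]) [set X | 0 <= frobenius (x *m x^T) X]).
  apply/seteqP; split=> [X [/symmetricmxP sX pX]|X [sX pX]]; split.
  - by move=> [i j] _ /=; rewrite sX subrr.
  - by move=> x _ /=; rewrite frobeniusC -quad_form_frobenius.
  - by apply/symmetricmxP => i j; apply/eqP; rewrite -subr_eq0; apply/eqP; exact: (sX (i, j)).
  - by move=> x; rewrite quad_form_frobenius frobeniusC; exact: pX.
apply: closedI; apply: closed_bigI => t _.
  apply: (closed_comp (D := [set 0])
    (f := fun X : 'M[R]_n => X t.1 t.2 - X t.2 t.1)) => [X _|].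
    apply: (@continuousB _ _ _ (fun Y : 'M[R]_n => Y t.1 t.2)
      (fun Y => Y t.2 t.1)); exact: coord_continuous.
  exact: closed_eq.
apply: (closed_comp (D := [set s | 0 <= s]) (f := frobenius (t *m t^T)))
  => [X _|].
  exact: frobenius_continuous.
exact: closed_ge.
Qed.

Lemma sqr_max_continuous (T : topologicalType) (f : T -> R) :
  continuous f -> continuous (fun x => Num.max (f x) 0 ^+ 2).
Proof.
move=> cf x.
have c : {for x, continuous (fun x => Num.max (f x) 0)}.
  by apply: (@continuous_max R T f (fun=> 0)); [exact: cf | exact: cvg_cst].
exact: (continuousM c c).
Qed.

End MatrixTopology.

(** * A Farkas alternative by penalty minimisation *)

Section Farkas.
Context {R : realType}.

(** The squared positive part is differentiable with derivative 2 max(t, 0), and its first-order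
    expansion errs from above by at most h^2. *)
Lemma sqr_max_add_le (t h : R) :
  Num.max (t + h) 0 ^+ 2 <= Num.max t 0 ^+ 2 + 2 * (Num.max t 0 * h) + h ^+ 2.
Proof. by case: (leP (t + h) 0); case: (leP t 0) => ? ?; nra. Qed.

Lemma sqr_max_le_shift (a c : R) :
  Num.max a 0 ^+ 2 <= 2 * Num.max (a - c) 0 ^+ 2 + 2 * c ^+ 2.
Proof.
case: (leP a 0); case: (leP (a - c) 0) => ? ?; rewrite ?expr0n /=; try nra.
by have := sqr_ge0 (a - c - c); nra.
Qed.

Lemma first_order_ge0 (a b : R) :
  (forall e, 0 < e <= 1 -> 0 <= e * (2 * a) + e ^+ 2 * b) -> 0 <= a.
Proof.
move=> H; rewrite leNgt; apply/negP => a0.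
have b0 := normr_ge0 b; have b1 := ler_norm b.
have d0 : 0 < - a + `|b| + 1 by lra.
(* With this step e |b| < -a, hence 2 a + e b < a < 0. *)
set e := - a / (- a + `|b| + 1).
have e0 : 0 < e by rewrite divr_gt0 //; lra.
have ed : e * (- a + `|b| + 1) = - a by rewrite divfK // gt_eqF.
have e1 : e <= 1 by rewrite ler_pdivrMr //; lra.
have := H e; rewrite e0 e1 => /(_ isT).
have -> : e * (2 * a) + e ^+ 2 * b = e * (2 * a + e * b) by ring.
rewrite pmulr_rge0 //; nra.
Qed.

Context {n : nat} {I : finType} (A : I -> 'M[R]_n).
Hypothesis no_recession : forall Z, psd Z ->
  (forall i, frobenius (A i) Z <= 0) -> Z = 0.

Let penalty (c : I -> R) (X : 'M[R]_n) : R :=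
  \sum_i Num.max (frobenius (A i) X - c i) 0 ^+ 2.

Let penalty_continuous c : continuous (penalty c).
Proof.
apply: continuous_sum => i; apply: sqr_max_continuous => X.
apply: (@continuousB _ R _ (frobenius (A i)) (fun=> c i)).
  exact: frobenius_continuous.
exact: cst_continuous.
Qed.

(** With zero right-hand sides the penalty is homogeneous of degree 2, so [k] can be its minimum
    over psd matrices of norm 1. That minimum is positive, since a zero would be a direction
    excluded by [no_recession]. *)
Let penalty0_coercive : exists2 k : R, 0 < k &
  forall X, psd X -> k * `|X| ^+ 2 <= penalty (fun=> 0) X.
Proof.
pose T := [set Z : 'M[R]_n | psd Z] `&` [set Z | `|Z| = 1].
have penalty_ge0 X : 0 <= penalty (fun=> 0) X.
  by apply: sumr_ge0 => i _; exact: sqr_ge0.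
have unit_psd X : psd X -> X != 0 -> T (`|X|^-1 *: X).
  move=> pX X0; split; first exact: psdZ.
  by rewrite /= normrZ ger0_norm ?invr_ge0// mulVf ?normr_eq0.
have [[Z0 TZ0]|noT] := pselect (T !=set0); last first.
  (* Degenerate case: 0 is the only psd matrix, and any positive constant works. *)
  exists 1 => // X pX; have [->|X0] := eqVneq X 0.
    by rewrite normr0 expr0n mulr0.
  by case: noT; exists (`|X|^-1 *: X); exact: unit_psd.
have cT : compact T.
  apply: (@bounded_closed_compact_mx _ _ _ _ 1) => [M [_ ->]//|].
  apply: closedI; first exact: psd_closed.
  apply: (closed_comp (f := fun Z : 'M[R]_n => `|Z|) (D := [set 1])) => [Z _|].
    exact: norm_continuous.
  exact: closed_eq.
have [||Z /set_mem [pZ Z1] Zmin] :=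
    @compact_EVT_min _ R (penalty (fun=> 0)) T _ cT.
- by exists Z0.
- exact/continuous_subspaceT/penalty_continuous.
exists (penalty (fun=> 0) Z).
  rewrite lt_def penalty_ge0 andbT; apply/eqP => pZ0.
  have /eqP : `|Z| = 0; last by rewrite Z1 oner_eq0.
  rewrite (no_recession Z) ?normr0 // => i.
  have /eqP := psumr_eq0P (fun j _ => sqr_ge0 _) pZ0 (i := i) isT.
  by rewrite sqrf_eq0 subr0 => /eqP/max_idPr.
move=> X pX; have [->|X0] := eqVneq X 0.
  by rewrite normr0 expr0n mulr0.
have /mem_set/Zmin := unit_psd X pX X0.
move/(ler_wpM2r (sqr_ge0 `|X|))/le_trans; apply.
rewrite mulr_suml ler_sum // => i _; rewrite !subr0 frobeniusZr.
rewrite -exprMn_comm; last exact: mulrC.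
rewrite maxr_pMl ?normr_ge0 // mul0r mulrAC mulVf ?mul1r ?normr_eq0 ?lexx //.
Qed.

Let penalty_bounded c : exists r : R,
  forall X, psd X -> penalty c X <= penalty c 0 -> `|X| <= r.
Proof.
have [k k0 kX] := penalty0_coercive.
pose s := \sum_i c i ^+ 2.
have s0 : penalty c 0 <= s.
  apply: ler_sum => i _; rewrite frobenius0r sub0r.
  by case: (leP (- c i) 0) => ?; nra.
(* The square of the norm is at most 4 s / k; t <= 1 + t^2 turns this into a bound on the norm
   without a square root. *)
exists (1 + 4 * s / k) => X pX Xc.
have kX4 : k * `|X| ^+ 2 <= 4 * s.
  apply: (le_trans (kX X pX)).
  apply: (@le_trans _ _ (2 * penalty c X + 2 * s)); last by lra.
  rewrite !mulr_sumr -big_split; apply: ler_sum => i _ /=.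
  by rewrite subr0 sqr_max_le_shift.
have : `|X| ^+ 2 <= 4 * s / k by rewrite ler_pdivlMr // mulrC.
by move: (4 * s / k) => u; have := normr_ge0 X; nra.
Qed.

(** The sublevel set at the value of 0 is compact, and psd matrices outside it have a larger
    penalty. *)
Let penalty_min c : exists2 X, psd X & forall Y, psd Y -> penalty c X <= penalty c Y.
Proof.
have [r Xr] := penalty_bounded c.
pose K := [set X : 'M[R]_n | psd X] `&` [set X | penalty c X <= penalty c 0].
have cK : compact K.
  apply: (@bounded_closed_compact_mx _ _ _ _ r) => [M [pM ?]|]; first exact: Xr.
  apply: closedI; first exact: psd_closed.
  apply: (closed_comp (f := penalty c) (D := [set t | t <= penalty c 0])) => [Z _|].
    exact: penalty_continuous.
  exact: closed_le.
have [||X /set_mem [pX X0] Xmin] := @compact_EVT_min _ R (penalty c) K _ cK.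
- by exists 0; split=> /=; [exact: psd0 | exact: lexx].
- exact/continuous_subspaceT/penalty_continuous.
exists X => // Y pY; have [Y0|/ltW] := leP (penalty c Y) (penalty c 0).
  by apply: Xmin; exact/mem_set.
exact: le_trans.
Qed.

(* At a minimiser of the penalty, the positive parts of the residuals form a
   dual certificate unless they all vanish: moving towards [x *m x^T] gives
   [\sum_i w i *: A i] psd, and shrinking the minimiser gives [wX] below. *)
Lemma psd_farkas (c : I -> R) :
  (exists2 X, psd X & forall i, frobenius (A i) X <= c i) \/
  (exists w : I -> R, [/\ forall i, 0 <= w i,
     forall x, 0 <= quad_form (\sum_i w i *: A i) x & \sum_i w i * c i < 0]).
Proof.
have [X pX Xmin] := penalty_min c.
pose w i := Num.max (frobenius (A i) X - c i) 0.
have w0 i : 0 <= w i by rewrite le_max lexx orbT.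
(* The sum is half the derivative of the penalty at [X] along [D], so it cannot be negative in a
   direction that stays in the cone. *)
have first_order D : (forall e, 0 < e <= 1 -> psd (X + e *: D)) ->
    0 <= \sum_i w i * frobenius (A i) D.
  move=> pD; apply: (first_order_ge0 _ (\sum_i frobenius (A i) D ^+ 2)) => e e01.
  have := Xmin _ (pD e e01); rewrite -subr_ge0 => /le_trans; apply.
  rewrite lerBlDl !mulr_sumr -!big_split; apply: ler_sum => i _ /=.
  rewrite frobeniusDr frobeniusZr addrAC (le_trans (sqr_max_add_le _ _)) //.
  by rewrite exprMn -/(w i) -!addrA lerD2l lerD2r; rewrite le_eqVlt; apply/orP; left; apply/eqP; ring.
have wX : \sum_i w i * frobenius (A i) X <= 0.
  have : 0 <= \sum_i w i * frobenius (A i) (- X).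
    apply: first_order => e /andP[_ e1].
    by rewrite scalerN -{1}(scale1r X) -scalerBl; apply: psdZ; rewrite ?subr_ge0.
  under eq_bigr => i _ do rewrite -scaleN1r frobeniusZr mulN1r mulrN.
  by rewrite sumrN oppr_ge0.
(* Since max(t, 0)^2 = max(t, 0) t. With [wX], a positive penalty then forces the sum of the
   [w i * c i] below 0. *)
have wE : penalty c X = \sum_i w i * frobenius (A i) X - \sum_i w i * c i.
  rewrite -sumrB; apply: eq_bigr => i _; rewrite -mulrBr /w.
  by case: leP => _; rewrite ?mul0r ?expr0n // expr2.
have [feas|] := pselect (forall i, frobenius (A i) X <= c i).
  by left; exists X.
move=> /existsNP[i /negP]; rewrite -ltNge -subr_gt0 => Xi.
right; exists w; split=> //.
  move=> x; rewrite quad_form_frobenius frobenius_suml; apply: first_order => e /andP[e0 _].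
  by apply: psdD => //; apply: psdZ; [exact: ltW | exact: psd_outer].
have : 0 < penalty c X.
  rewrite /penalty (bigD1 i) //= ltr_pwDl ?sumr_ge0 // => [|j _]; last exact: sqr_ge0.
  by rewrite exprn_gt0 // lt_max Xi.
lra.
Qed.

End Farkas.

(** * The rank-one candidate built from a diagonal *)

Section SignedSqrtDiag.
Context {R : realType} {n : nat}.
Implicit Types (L : {set 'I_n}) (S X : 'M[R]_n).

Definition signed_sqrt_diag L X : 'cV[R]_n :=
  \col_i ((-1) ^+ (i \in L) * Num.sqrt (X i i)).

Lemma signed_sqrt_diag_cross L X i j : (i \in L) != (j \in L) ->
  signed_sqrt_diag L X i 0 * signed_sqrt_diag L X j 0 =
  - (Num.sqrt (X i i) * Num.sqrt (X j j)).
Proof. by rewrite !mxE; case: (i \in L); case: (j \in L) => //= _; ring. Qed.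

Lemma signed_sqrt_diag_sqr L X i : psd X ->
  signed_sqrt_diag L X i 0 * signed_sqrt_diag L X i 0 = X i i.
Proof.
move=> pX; rewrite -expr2 mxE exprMn sqrr_sign mul1r sqr_sqrtr //.
exact: psd_diag_ge0.
Qed.

Variables (e : rel 'I_n) (L : {set 'I_n}) (S X : 'M[R]_n).
Hypothesis eL : forall i j, e i j -> (i \in L) != (j \in L).
Hypothesis S_edge : forall i j, e i j -> 0 < S i j.
Hypothesis S_nonedge : forall i j, i != j -> ~~ e i j -> S i j = 0.
Hypothesis pX : psd X.

Let z := signed_sqrt_diag L X.

Let entry_le i j : S i j * (z *m z^T) i j <= S i j * X i j.
Proof.
rewrite !mxE big_ord1 [z^T _ _]mxE; have [<-|ij] := eqVneq i j.
  by rewrite signed_sqrt_diag_sqr.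
have [eij|/S_nonedge->//] := boolP (e i j); last by rewrite !mul0r.
rewrite ler_pM2l ?S_edge // signed_sqrt_diag_cross ?eL // lerNl.
by apply: le_trans (psd_le_sqrt_diag X i j pX); rewrite -normrN ler_norm.
Qed.

Lemma quad_form_signed_sqrt_diag_le : quad_form S z <= frobenius S X.
Proof.
rewrite quad_form_frobenius; apply: ler_sum => i _; apply: ler_sum => j _.
exact: entry_le.
Qed.

(** The entrywise gaps are nonnegative and now sum to 0, so each vanishes; on an edge the positive
    factor [S i j] cancels. *)
Lemma signed_sqrt_diag_outer_edge : frobenius S X <= quad_form S z ->
  forall i j, e i j -> (z *m z^T) i j = X i j.
Proof.
rewrite quad_form_frobenius /frobenius !pair_bigA /= => le_Sz i j eij.
apply: (mulfI (lt0r_neq0 (S_edge _ _ eij))).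
have ge0 (p : 'I_n * 'I_n) : true ->
    0 <= S p.1 p.2 * X p.1 p.2 - S p.1 p.2 * (z *m z^T) p.1 p.2.
  by rewrite subr_ge0 entry_le.
have sum0 : \sum_(p : 'I_n * 'I_n)
    (S p.1 p.2 * X p.1 p.2 - S p.1 p.2 * (z *m z^T) p.1 p.2) = 0.
  by apply: le_anti; rewrite sumr_ge0 // andbT sumrB subr_le0.
by apply/esym/eqP; rewrite -subr_eq0; apply/eqP; exact: (psumr_eq0P ge0 sum0 (i := (i, j))).
Qed.

End SignedSqrtDiag.

(** * Zero duality gap and the rank-one optimal solution *)

Theorem theorem4p4 (R : realType) (n m : nat)
    (Q : 'I_m.+1 -> 'M[R]_n) (b : 'cV[R]_m)
    (Qsym : forall p, Q p \is symmetricmx)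
    (Pfeas : qcqp_feasible Q b !=set0)
    (HB : assumptionB Q b)
    (Gbip : bipartite (sparsity_edge Q))
    (Hedge : forall k l : 'I_n, sparsity_edge Q k l ->
       ~ exists y : 'cV[R]_m,
           [/\ forall p, 0 <= y p 0,
               psd (dual_slack Q y)
             & dual_slack Q y k l <= 0]) :
  sdp_exact Q b.
Proof.
have [L eL] := Gbip.
have slackE y X : frobenius (dual_slack Q y) X =
    frobenius (Q ord0) X + \sum_p y p 0 * frobenius (Q (lift ord0 p)) X.
  rewrite /dual_slack frobeniusC frobeniusDr frobeniusC; congr (_ + _).
  by rewrite frobeniusC frobenius_suml.
have slack_nonedge y i j : i != j -> ~~ sparsity_edge Q i j ->
    dual_slack Q y i j = 0.
  rewrite /sparsity_edge => ->; rewrite /= negb_exists => /forallP Qij.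
  have {}Qij p : Q p i j = 0 by apply/eqP; have := Qij p; rewrite negbK.
  rewrite mxE Qij add0r summxE big1 // => p _.
  by rewrite mxE Qij mulr0.
have slack_edge y i j : dual_feasible Q y -> sparsity_edge Q i j ->
    0 < dual_slack Q y i j.
  move=> [y0 yS] eij; rewrite ltNge; apply/negP => yij.
  by apply: (Hedge _ _ eij); exists y.
have [[X [[pX Xb] Xopt]] [y [[y0 yS] yopt]] caseB] := HB.
have no_recession Z : psd Z -> (forall p, frobenius (Q p) Z <= 0) -> Z = 0.
  (* In case (b) the sign argument is applied to Z and a strictly feasible dual
     slack: its quadratic form is nonpositive at the signed root of diag Z. *)
  move=> pZ QZ; case: caseB => [[M [_ bM]]|[_ [y1 fy1 [_ pd1]]]].
    apply/eqP; apply: contrapT => /negP Z0.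
    have nZ0 : 0 < `|Z| by rewrite normr_gt0.
    have M1 : M < `|M| + 1 by have := ler_norm M; lra.
    (* Chosen so that [X + t *: Z] has norm at least |M| + 2, while feasible points have norm at
       most |M| + 1. *)
    pose t := (`|M| + 2 + `|X|) / `|Z|.
    have t0 : 0 <= t by rewrite divr_ge0 // !addr_ge0.
    have ray : sdp_feasible Q b (X + t *: Z).
      split=> [|p]; first by apply: psdD => //; exact: psdZ.
      rewrite frobeniusDr frobeniusZr -[leRHS]addr0 lerD //.
      by rewrite mulr_ge0_le0.
    have := bM _ M1 _ ray => /=.
    have := lerB_normD (t *: Z) X; rewrite [t *: Z + X]addrC normrZ (ger0_norm t0).
    by rewrite divfK ?gt_eqF //; lra.
  pose u := signed_sqrt_diag L Z.
  have u0 : u = 0.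
    apply/eqP; apply: contrapT => /negP /pd1; apply/negP; rewrite -leNgt.
    apply: le_trans (quad_form_signed_sqrt_diag_le _ _ _ _ eL
      (fun i j => slack_edge y1 i j fy1) (slack_nonedge y1) pZ) _.
    rewrite slackE -[leRHS]addr0 lerD // sumr_le0 // => p _.
    by rewrite mulr_ge0_le0 //; case: fy1.
  have Zii i : Z i i = 0 by rewrite -(signed_sqrt_diag_sqr L Z i pZ) -/u u0 mxE mul0r.
  apply/matrixP => i j; rewrite mxE; apply/eqP; rewrite -sqrf_eq0.
  by rewrite eq_le sqr_ge0 andbT (le_trans (psd_minor Z i j pZ)) // Zii mul0r.
pose v := dual_objective b y.
(* Index 0 carries the bound [v] on the objective: solving this system means finding a primal
   feasible point of value at most the dual optimum. *)
pose c p := if unlift ord0 p is Some j then b j 0 else v.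
have sum_c (w : 'I_m.+1 -> R) :
    \sum_p w p * c p = w ord0 * v + \sum_p w (lift ord0 p) * b p 0.
  rewrite big_ord_recl /c unlift_none; congr (_ + _).
  by apply: eq_bigr => p _; rewrite liftK.
have vE y' : dual_objective b y' = - \sum_p y' p 0 * b p 0.
  by rewrite /dual_objective mxE; congr (- _); apply: eq_bigr => p _; rewrite mxE mulrC.
have Xv : frobenius (Q ord0) X <= v.
  have [[X' pX' X'c]|[w [w0 wQ wc]]] := psd_farkas _ no_recession c.
    have X'b : sdp_feasible Q b X'.
      by split=> // p; have := X'c (lift ord0 p); rewrite /c liftK.
    by apply: le_trans (Xopt _ X'b) _; have := X'c ord0; rewrite /c unlift_none.
  have sW : (\sum_p w p *: Q p) \is symmetricmx.
    apply/symmetricmxP => i j; rewrite !summxE; apply: eq_bigr => p _.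
    by rewrite !mxE; have /symmetricmxP-> := Qsym p.
  have pW : psd (\sum_p w p *: Q p) by split.
  (* A certificate would contradict the optimality of [y]. If its weight on the objective is 0, it
     is a dual direction that strictly improves [y]; otherwise dividing by that weight gives a dual
     feasible point of value above [v]. *)
  have [w00|w0_neq0] := eqVneq (w ord0) 0.
    have yw_feas : dual_feasible Q (y + \col_p w (lift ord0 p)).
      split=> [p|]; first by rewrite !mxE addr_ge0.
      have -> : dual_slack Q (y + \col_p w (lift ord0 p)) =
          dual_slack Q y + \sum_p w p *: Q p; last exact: psdD.
      rewrite big_ord_recl w00 scale0r add0r -addrA -big_split; congr (_ + _).
      by apply: eq_bigr => p _; rewrite !mxE scalerDl.
    have := yopt _ yw_feas; rewrite -/v /v !vE lerN2 leNgt; case/negP.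
    rewrite sum_c w00 mul0r add0r in wc.
    under eq_bigr => p _ do rewrite !mxE mulrDl.
    by rewrite big_split /= gtrDl.
  have w0_gt0 : 0 < w ord0 by rewrite lt_def w0_neq0 w0.
  have w_feas : dual_feasible Q (\col_p ((w ord0)^-1 * w (lift ord0 p))).
    split=> [p|]; first by rewrite mxE mulr_ge0 // invr_ge0.
    have -> : dual_slack Q (\col_p ((w ord0)^-1 * w (lift ord0 p))) =
        (w ord0)^-1 *: \sum_p w p *: Q p; last by apply: psdZ; rewrite ?invr_ge0.
    rewrite big_ord_recl scalerDr scalerA mulVf // scale1r scaler_sumr.
    by congr (_ + _); apply: eq_bigr => p _; rewrite mxE scalerA.
  have := yopt _ w_feas; rewrite -/v vE leNgt; case/negP.
  rewrite sum_c in wc.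
  under eq_bigr => p _ do rewrite mxE -mulrA.
  by rewrite -mulr_sumr ltrNr mulrC ltr_pdivrMr // mulNr; lra.
(* Complementary slackness: weighting the constraints on [X] by [y] bounds the second part of
   [slackE] by -v. *)
have SX : frobenius (dual_slack Q y) X <= 0.
  suff : \sum_p y p 0 * frobenius (Q (lift ord0 p)) X <= - v.
    by rewrite slackE; lra.
  by rewrite /v vE opprK; apply: ler_sum => p _; rewrite ler_wpM2l.
pose z := signed_sqrt_diag L X.
have zX i j : sparsity_edge Q i j -> (z *m z^T) i j = X i j.
  apply: (signed_sqrt_diag_outer_edge _ _ _ _ eL (fun i j => slack_edge y i j _)
    (slack_nonedge y) pX) => //.
  exact: le_trans SX (yS.2 z).
have zQ p : frobenius (Q p) (z *m z^T) = frobenius (Q p) X.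
  apply: eq_bigr => i _; apply: eq_bigr => j _.
  have [<-|ij] := eqVneq i j.
    by rewrite mxE big_ord1 [z^T _ _]mxE signed_sqrt_diag_sqr.
  have [->|Qij] := eqVneq (Q p i j) 0; first by rewrite !mul0r.
  by rewrite zX // /sparsity_edge ij; apply/existsP; exists p.
exists (z *m z^T); last exact: (leq_trans (mulmx_max_rank _ _)).
split=> [|X' X'b]; last by rewrite zQ; exact: Xopt.
by split=> [|p]; [exact: psd_outer | rewrite zQ].
Qed.
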